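(* Let $M\in\mathbb{R}^{m\times n}$ be a matrix with operator norm $\|M\|_2=1$, and let $\alpha>0$. Then $$\triangle_2(M)\ \ge\ \frac{\alpha}{\kappa_2(M)} .$$
   Context: The $n$ columns $M_1,\dots,M_n$ of $M$ are indexed by $n$ possible source locations, identified with the standard basis vectors $e_1,\dots,e_n$. Certain pairs of distinct locations are called neighbours, and every two locations are connected by a path travelling via neighbours. For $\alpha>0$, $$\triangle_2(M)=\alpha\max_{e_i,e_j\ \text{neighbours}}\|M_i-M_j\|_2 .$$ Let $s_1\le s_2\le\dots\le s_{\min\{m,n\}}$ be the singular values of $M$. The condition number is $\kappa_2(M)=s_{\min\{m,n\}}/s_1$ (with $1/\kappa_2(M)=0$ if $s_1=0$).
   Formalization: Assumes n ≥ 2 (otherwise no neighbours exist) and that either n ≤ m or s_1 = 0; for m < n with s_1 > 0 the claim can fail, e.g. M = (1/√2, 1/√2) with m = 1, n = 2, where κ_2 = 1 but M_1 = M_2, so △_2(M) = 0. *)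

(* Defs.v *)
From HB Require Import structures.
From mathcomp Require Import all_boot all_order all_algebra.
From mathcomp Require Import all_classical all_reals.
From mathcomp Require Import polyrcf.

Set Implicit Arguments.
Unset Strict Implicit.
Unset Printing Implicit Defensive.

Import Order.TTheory GRing.Theory Num.Theory.
Local Open Scope classical_set_scope.
Local Open Scope ring_scope.

(* The library's norm on matrices is the max norm, hence this definition. *)
Definition l2norm (R : realType) (k : nat) (x : 'cV[R]_k) : R :=
  Num.sqrt (\sum_(i < k) x i 0 ^+ 2).

Definition opnorm2 (R : realType) (m n : nat) (M : 'M[R]_(m, n)) : R :=
  sup [set l2norm (M *m x) | x in [set x : 'cV[R]_n | l2norm x <= 1]].

(* [rootsR] is increasing and lists each real root once, so each root is
   repeated according to its multiplicity.  For a symmetric matrix this is the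
   whole spectrum. *)
Definition eigenvalue_seq (R : realType) (n : nat) (A : 'M[R]_n) : seq R :=
  flatten [seq nseq (mup x (char_poly A)) x | x <- rootsR (char_poly A)].

(* Increasing sequence of the min(m, n) singular values: square roots of the
   min(m, n) largest eigenvalues of M^T M.  When m < n, the n - m eigenvalues
   dropped are zeros forced by rank M <= m. *)
Definition singular_values (R : realType) (m n : nat) (M : 'M[R]_(m, n)) :
    seq R :=
  drop (n - minn m n) [seq Num.sqrt x | x <- eigenvalue_seq (M^T *m M)].

(* Indexed from 1, as in s_1 <= ... <= s_min(m, n). *)
Definition singular_value (R : realType) (m n : nat) (M : 'M[R]_(m, n))
    (k : nat) : R :=
  (singular_values M)`_k.-1.

(* The condition number is infinite when s_1 = 0.  Here x / 0 = 0 and 0^-1 = 0,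
   so that (kappa2 M)^-1 = 0 in this case, as it should be. *)
Definition kappa2 (R : realType) (m n : nat) (M : 'M[R]_(m, n)) : R :=
  singular_value M (minn m n) / singular_value M 1.

(* The default value 0 of the maximum is harmless: the terms are nonnegative. *)
Definition triangle2 (R : realType) (m n : nat) (nb : rel 'I_n) (alpha : R)
    (M : 'M[R]_(m, n)) : R :=
  alpha * \big[Num.max/0]_(p : 'I_n * 'I_n | nb p.1 p.2)
            l2norm (col p.1 M - col p.2 M).

(* Main.v *)
(** If M^T M = P^* D P with P unitary and D diagonal, then
    |M x|^2 = sum_i d_i |(P x)_i|^2, which lies between s_1^2 |x|^2 and
    s_n^2 |x|^2 when n <= m.  The upper bound gives s_n >= ||M||_2 = 1, hence
    1 / kappa_2(M) <= s_1.  The lower bound at x = e_i - e_j, where i and j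
    are neighbours, gives s_1 <= s_1 |x| <= |M_i - M_j|.  If s_1 = 0, then
    1 / kappa_2(M) = 0 and there is nothing to prove. *)

Require Import Defs.
From mathcomp Require Import all_boot all_order all_algebra.
From mathcomp Require Import all_classical all_reals.
From mathcomp Require Import complex polyrcf.

Set Implicit Arguments.
Unset Strict Implicit.
Unset Printing Implicit Defensive.

Import Order.TTheory GRing.Theory Num.Theory.
Local Open Scope ring_scope.

Lemma count_mem_flatten_nseq (T : eqType) (f : T -> nat) (s : seq T) (x : T) :
  uniq s ->
  count_mem x (flatten [seq nseq (f y) y | y <- s]) =
    if x \in s then f x else 0%N.
Proof.
elim: s => [//|y s IHs] /= /andP[ys us].
rewrite count_cat count_nseq IHs //= in_cons.
have [<-|nyx] := eqVneq y x; first by rewrite (negbTE ys) addn0 mul1n.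
by rewrite mul0n.
Qed.

Lemma pairwise_flatten_nseq (R : realType) (f : R -> nat) (s : seq R) :
  pairwise <%R s -> pairwise <=%R (flatten [seq nseq (f x) x | x <- s]).
Proof.
elim: s => [//|x s IHs] /= /andP[xs ps]; rewrite pairwise_cat IHs // andbT.
apply/andP; split.
  apply/allrelP => a b; rewrite mem_nseq => /andP[_ /eqP ->].
  move=> /flatten_mapP[y ys]; rewrite mem_nseq => /andP[_ /eqP ->].
  by apply/ltW/(allP xs).
by elim: (f x) => [//|k IHk] /=; rewrite IHk andbT all_nseq lexx orbT.
Qed.

Lemma eigenvalue_seq_sorted (R : realType) (n : nat) (A : 'M[R]_n) :
  sorted <=%R (eigenvalue_seq A).
Proof.
rewrite sorted_pairwise; last exact: le_trans.
apply: pairwise_flatten_nseq; rewrite -sorted_pairwise ?sorted_roots //.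
exact: lt_trans.
Qed.

(** Together with sortedness, this characterizes [eigenvalue_seq]: outside [rootsR] both counts are
    0. *)
Lemma count_mem_eigenvalue_seq (R : realType) (n : nat) (A : 'M[R]_n) (x : R) :
  count_mem x (eigenvalue_seq A) = mup x (char_poly A).
Proof.
have uniq_roots : uniq (rootsR (char_poly A)).
  by apply: (sorted_uniq lt_trans ltxx); apply: sorted_roots.
rewrite count_mem_flatten_nseq //.
rewrite -roots_on_rootsR ?monic_neq0 ?char_poly_monic //=.
by case: ifPn => // /mupNroot.
Qed.

(** Over polynomials, P (X - A) = (X - B) P; take determinants and cancel det P, which is
    nonzero. *)
Lemma char_poly_similar (F : fieldType) (n : nat) (P A B : 'M[F]_n) :
  P \in unitmx -> P *m A = B *m P -> char_poly A = char_poly B.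
Proof.
move=> Punit PABP; pose Q := map_mx polyC P.
have detQ : \det Q != 0.
  by rewrite det_map_mx polyC_eq0 -unitfE -unitmxE.
apply: (mulfI detQ); rewrite -[LHS]det_mulmx [RHS]mulrC -[RHS]det_mulmx.
congr (\det _); rewrite /char_poly_mx mulmxBr mulmxBl scalar_mxC.
by rewrite -!map_mxM PABP.
Qed.

Section RealSpectral.
Local Open Scope sesquilinear_scope.
Local Open Scope complex_scope.
Local Notation toC := (real_complex _).

(** A is diagonalized by a unitary P over the complex numbers. Only the eigenvalues and the weights
    |(P x)_i|^2 leave the proof, so the statement stays real. *)
Lemma symmetric_spectral (R : realType) (n : nat) (A : 'M[R]_n) :
  A^T = A ->
  exists d : 'I_n -> R,
    char_poly A = \prod_(i < n) ('X - (d i)%:P) /\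
    forall x : 'cV[R]_n, exists w : 'I_n -> R,
      [/\ forall i, 0 <= w i,
          (x^T *m A *m x) 0 0 = \sum_i d i * w i
        & (x^T *m x) 0 0 = \sum_i w i].
Proof.
move=> symA; pose B := map_mx toC A.
have hermB : B \is hermsymmx.
  apply: realsym_hermsym.
    apply/is_hermitianmxP; rewrite expr0 scale1r.
    by apply/matrixP => i j; rewrite !mxE -[in LHS]symA mxE.
  by apply/mxOverP => i j; rewrite mxE complex_real.
have dreal := hermitian_spectral_diag_real hermB.
have := hermitian_normalmx hermB => /orthomx_spectralP.
set P := spectralmx B; set D := spectral_diag B => BE.
have Punit : P \is unitarymx := spectral_unitarymx B.
pose d i := complex.Re (D 0 i).
have dE i : D 0 i = (d i)%:C by rewrite /d RRe_real // (mxOverP dreal).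
exists d; split.
  apply: (map_poly_inj toC); rewrite map_char_poly -/B.
  rewrite (@char_poly_similar _ _ P _ (diag_mx D)) ?unitarymx_unit //; last first.
    by rewrite BE mulmxA mulmxA mulmxV ?mul1mx // unitarymx_unit.
  rewrite char_poly_trig ?diag_mx_is_trig // rmorph_prod /=.
  by apply: eq_bigr => i _; rewrite map_polyXsubC mxE eqxx mulr1n dE.
move=> x; pose X := map_mx toC x.
have [y yE] : exists y, y = P *m X by exists (P *m X).
(* The inverse of P is its adjoint, and X^T is the adjoint of X because X has real entries. *)
have XP : X^T *m invmx P = y^t*.
  rewrite yE invmx_unitary // trmx_mul map_mxM; congr (_ *m _).
  apply/matrixP => i j; rewrite !mxE.
  by apply/esym/CrealP; rewrite complex_real.
pose w i := complex.Re (y i 0) ^+ 2 + complex.Im (y i 0) ^+ 2.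
have wE i : (w i)%:C = (y i 0)^* * y i 0.
  by rewrite add_Re2_Im2 normCKC.
have toCE (B' : 'M_1) : (B' 0 0)%:C = map_mx toC B' 0 0 by rewrite mxE.
exists w; split.
- by move=> i; rewrite addr_ge0 // sqr_ge0.
- apply: complexI; rewrite toCE !map_mxM -/B -map_trmx -/X BE.
  rewrite !mulmxA XP -!mulmxA -yE mxE rmorph_sum /=; apply: eq_bigr => i _.
  by rewrite mul_diag_mx !mxE dE rmorphM /= wE mulrCA.
- have XX : X^T *m X = y^t* *m y.
    by rewrite -XP yE mulmxA mulmxKV // unitarymx_unit.
  apply: complexI; rewrite toCE map_mxM -map_trmx -/X XX mxE rmorph_sum /=.
  by apply: eq_bigr => i _; rewrite !mxE wE.
Qed.

End RealSpectral.

(** The quadratic form is a sum of eigenvalues with nonnegative weights of total x^T x, so bounding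
    each eigenvalue by the extreme ones suffices. *)
Lemma eigenvalue_seq_rayleigh (R : realType) (n : nat) (A : 'M[R]_n)
    (x : 'cV[R]_n) :
  A^T = A ->
  (eigenvalue_seq A)`_0 * (x^T *m x) 0 0 <= (x^T *m A *m x) 0 0
    <= (eigenvalue_seq A)`_n.-1 * (x^T *m x) 0 0.
Proof.
move=> /symmetric_spectral[d [charA /(_ x)[w [w_ge0 -> ->]]]].
pose s := [seq d i | i <- enum 'I_n].
(* Both lists count y as often as y is a root of the product of the X - d_i. Hence there are exactly
   n real eigenvalues, and [n.-1] indexes the last. *)
have eig_s : perm_eq (eigenvalue_seq A) s.
  apply/allP => y _ /=; apply/eqP; rewrite count_mem_eigenvalue_seq charA.
  by rewrite -mu_prod_XsubC big_map big_enum.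
have size_eig : size (eigenvalue_seq A) = n.
  by rewrite (perm_size eig_s) size_map size_enum_ord.
have le_eig := sorted_leq_nth le_trans lexx 0 (eigenvalue_seq_sorted A).
have d_bounds i : (eigenvalue_seq A)`_0 <= d i <= (eigenvalue_seq A)`_n.-1.
  have : d i \in eigenvalue_seq A.
    by rewrite (perm_mem eig_s) map_f // mem_enum.
  move=> /(nthP 0)[k]; rewrite size_eig => k_lt <-.
  have n_gt0 := leq_ltn_trans (leq0n k) k_lt.
  have k_le : (k <= n.-1)%N by rewrite -ltnS prednK.
  by apply/andP; split; apply: le_eig; rewrite // inE size_eig ?prednK.
by rewrite !mulr_sumr; apply/andP; split; apply: ler_sum => i _;
  rewrite ler_wpM2r //; case/andP: (d_bounds i).
Qed.

Lemma l2norm_ge0 (R : realType) (k : nat) (x : 'cV[R]_k) : 0 <= l2norm x.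
Proof. exact: sqrtr_ge0. Qed.

Lemma l2normE (R : realType) (k : nat) (x : 'cV[R]_k) :
  l2norm x = Num.sqrt ((x^T *m x) 0 0).
Proof.
by congr Num.sqrt; rewrite mxE; apply: eq_bigr => i _; rewrite mxE expr2.
Qed.

Lemma l2norm0 (R : realType) (k : nat) : l2norm (0 : 'cV[R]_k) = 0.
Proof. by rewrite l2normE mulmx0 mxE sqrtr0. Qed.

Lemma singular_valueE (R : realType) (m n : nat) (M : 'M[R]_(m, n)) (k : nat) :
  singular_value M k =
    Num.sqrt (drop (n - minn m n) (eigenvalue_seq (M^T *m M)))`_k.-1.
Proof.
rewrite /singular_value /singular_values -map_drop.
set s := drop _ _; have [lt_ks|le_sk] := ltnP k.-1 (size s).
  by rewrite (nth_map 0).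
(* Out of range both sides are 0, since the root of the default 0 is 0. *)
by rewrite !nth_default ?size_map // sqrtr0.
Qed.

Lemma singular_value_bounds (R : realType) (m n : nat) (M : 'M[R]_(m, n))
    (x : 'cV[R]_n) :
  (0 < n <= m)%N ->
  singular_value M 1 * l2norm x <= l2norm (M *m x)
    <= singular_value M n * l2norm x.
Proof.
move=> /andP[n_gt0 le_nm].
have symMM : (M^T *m M)^T = M^T *m M by rewrite trmx_mul trmxK.
have xx_ge0 : 0 <= (x^T *m x) 0 0.
  by rewrite mxE sumr_ge0 // => i _; rewrite mxE -expr2 sqr_ge0.
have := eigenvalue_seq_rayleigh x symMM; rewrite !mulmxA => /andP[lo hi].
(* As n <= m, nothing is dropped: s_1 and s_n come from the extreme eigenvalues. *)
rewrite !singular_valueE (minn_idPr le_nm) subnn drop0.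
(* [sqrtrM] asks only its first factor to be nonnegative, so x^T x is moved to the front. *)
rewrite !l2normE trmx_mul !mulmxA ![Num.sqrt _`__ * _]mulrC -!sqrtrM //.
by rewrite !ler_wsqrtr // mulrC.
Qed.

Lemma singular_value_max_ge_opnorm2 (R : realType) (m n : nat)
    (M : 'M[R]_(m, n)) :
  (0 < n <= m)%N -> opnorm2 M <= singular_value M n.
Proof.
move=> nm; apply: ge_sup.
  by exists 0; exists 0; rewrite /= ?mulmx0 l2norm0.
move=> _ [x /= x_le1 <-]; have /andP[_] := singular_value_bounds M x nm.
by move/le_trans; apply; rewrite ler_piMr // singular_valueE sqrtr_ge0.
Qed.

Lemma connect_edge (T : finType) (e : rel T) (x y : T) :
  connect e x y -> x != y -> exists z, e x z.
Proof.
move=> /connectP[[|z p] /=]; first by move=> _ ->; rewrite eqxx.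
by move=> /andP[exz _] _ _; exists z.
Qed.

Lemma l2norm_delta_sub (R : realType) (n : nat) (i j : 'I_n) :
  i != j -> 1 <= l2norm (delta_mx i 0 - delta_mx j 0 : 'cV[R]_n).
Proof.
move=> ij; rewrite -[X in X <= _]sqrtr1 ler_wsqrtr // (bigD1 i) //= !mxE.
rewrite !eqxx (negbTE ij) subr0 expr1n lerDl sumr_ge0 // => k _.
exact: sqr_ge0.
Qed.

(** [M_shape] excludes wide matrices such as (1 1)/sqrt 2, whose only singular value is 1 but whose
    columns coincide. For n = 1 there are no neighbours, and M = (1) would be a counterexample. *)
Theorem lemma6 (R : realType) (m n : nat) (nb : rel 'I_n)
    (nb_sym : symmetric nb) (nb_irr : irreflexive nb)
    (nb_conn : forall i j : 'I_n, connect nb i j)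
    (n_gt1 : (1 < n)%N)
    (alpha : R) (alpha_gt0 : 0 < alpha)
    (M : 'M[R]_(m, n)) (M_norm1 : opnorm2 M = 1)
    (M_shape : (n <= m)%N \/ singular_value M 1 = 0) :
  alpha / kappa2 M <= triangle2 nb alpha M.
Proof.
have edge_le (p : 'I_n * 'I_n) : nb p.1 p.2 ->
    l2norm (col p.1 M - col p.2 M) <=
    \big[Num.max/0]_(p : 'I_n * 'I_n | nb p.1 p.2)
      l2norm (col p.1 M - col p.2 M).
  by move=> nbp; rewrite (bigD1 p) //= le_max lexx.
(* As 0^-1 = 0, the inverse of [kappa2 M] is s_1 / s_min(m, n) even when s_1 = 0. *)
rewrite /triangle2 ler_pM2l // /kappa2 invf_div.
have n_gt0 : (0 < n)%N by apply: ltnW.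
(* The first edge of a path from location 0 to location 1. *)
have [z nbz] : exists z, nb (Ordinal n_gt0) z.
  by apply: (connect_edge (nb_conn _ (Ordinal n_gt1))).
apply: le_trans (edge_le (_, z) nbz) => /=.
have [->|s1_neq0] := eqVneq (singular_value M 1) 0.
  by rewrite mul0r l2norm_ge0.
have le_nm : (n <= m)%N by case: M_shape => // /eqP; rewrite (negbTE s1_neq0).
rewrite (minn_idPr le_nm).
have nm : (0 < n <= m)%N by rewrite n_gt0.
have sn_ge1 : 1 <= singular_value M n.
  by rewrite -M_norm1 singular_value_max_ge_opnorm2.
rewrite !colE -mulmxBr.
set x := _ - _; have /andP[lo _] := singular_value_bounds M x nm.
apply: le_trans lo.
(* It remains to see that s_1 <= s_1 (|x| s_n), where both |x| and s_n are at least 1. *)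
rewrite ler_pdivrMr ?(lt_le_trans ltr01) // -mulrA ler_peMr //.
  by rewrite singular_valueE sqrtr_ge0.
rewrite mulr_ege1 // l2norm_delta_sub //.
by apply: contraTneq nbz => <-; rewrite nb_irr.
Qed.
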